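(* Let $m\geq 2$ be a constant integer. For $\mathcal{G}=(K_{m\times n})_{n\in\mathbb{N}}$, where $K_{m\times n}$ is the complete $m$-partite graph with $n$ vertices in each part, the function $t_{\mathcal{G}}(n)=(m-1)n/(2\ln n)$ is a sharp DP-threshold function for $\mathcal{G}$.
   Context: All graphs are finite and simple. $\mathbb{N}=\{0,1,2,\ldots\}$ and $[k]=\{1,\ldots,k\}$. A (DP-)cover of a graph $G$ is a pair $\mathcal{H}=(L,H)$ where $H$ is a graph and $L:V(G)\to 2^{V(H)}$ is such that: $\{L(v):v\in V(G)\}$ is a partition of $V(H)$ into $|V(G)|$ independent sets; for each edge $uv\in E(G)$ the edges of $H$ between $L(u)$ and $L(v)$ form a matching; and $H$ has no other edges than those between $L(u)$ and $L(v)$ with $uv\in E(G)$. A transversal is a set $T\subseteq V(H)$ containing exactly one vertex of each $L(v)$; it is independent if it is an independent set in $H$. $G$ is $\mathcal{H}$-colorable if $\mathcal{H}$ has an independent transversal. For $k\in\mathbb{N}$, the random $k$-fold cover $\mathcal{H}(G,k)=(L,H)$ is defined by $L(v)=\{(v,i):i\in[k]\}$ for $v\in V(G)$ and, independently for each edge $uv\in E(G)$, the edges of $H$ between $L(u)$ and $L(v)$ form a perfect matching chosen uniformly at random among the $k!$ perfect matchings between $L(u)$ and $L(v)$ ($H$ has no other edges). Let $\mathcal{G}=(G_\lambda)_{\lambda\in\mathbb{N}}$ be a sequence of graphs and $\kappa=(k_\lambda)_{\lambda\in\mathbb{N}}$ a sequence with $k_\lambda\in\mathbb{N}$. $\mathcal{G}$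 is $\kappa$-DP-colorable w.h.p. if $\lim_{\lambda\to\infty}\mathbb{P}(G_\lambda\text{ is }\mathcal{H}(G_\lambda,k_\lambda)\text{-colorable})=1$, and non-$\kappa$-DP-colorable w.h.p. if this limit equals $0$. A function $t_{\mathcal{G}}:\mathbb{N}\to\mathbb{R}$ is a sharp DP-threshold function for $\mathcal{G}$ if for any $\varepsilon>0$ and any such $\kappa$: $\mathcal{G}$ is non-$\kappa$-DP-colorable w.h.p. when $k_\lambda\leq(1-\varepsilon)t_{\mathcal{G}}(\lambda)$ for all large enough $\lambda$, and $\mathcal{G}$ is $\kappa$-DP-colorable w.h.p. when $k_\lambda\geq(1+\varepsilon)t_{\mathcal{G}}(\lambda)$ for all large enough $\lambda$. Only large $\lambda$ matter, so values of $t_{\mathcal{G}}$ at the finitely many indices where the given formula is undefined may be chosen arbitrarily. *)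

(* Defs.v *)
From HB Require Import structures.
From mathcomp Require Import all_boot all_order all_algebra all_fingroup.
From mathcomp Require Import all_classical all_reals all_analysis.
Set Implicit Arguments.
Unset Strict Implicit.
Unset Printing Implicit Defensive.
Import Order.TTheory GRing.Theory Num.Theory.
Import numFieldNormedType.Exports.
Local Open Scope ring_scope.

Record sgraph := SGraph {
  vertex :> finType;
  adj : rel vertex;
  adj_sym : symmetric adj;
  adj_irrefl : irreflexive adj }.

Definition independent (H : sgraph) (T : {set H}) : bool :=
  [forall x in T, forall y in T, ~~ adj x y].

(* The lists partition V(H), but a list may be empty: this happens exactly for
   0-fold covers, which are allowed. *)
Record dp_cover (G : sgraph) := DPCover {
  cover_graph : sgraph;
  cover_list : G -> {set cover_graph};
  cover_partition : forall x, exists! v, x \in cover_list v;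
  cover_indep : forall v, independent (cover_list v);
  cover_matching : forall u v x, adj u v -> x \in cover_list u ->
    (#|[set y in cover_list v | adj x y]| <= 1)%N;
  cover_no_other_edge : forall u v x y,
    x \in cover_list u -> y \in cover_list v -> adj x y -> adj u v }.

Section Colorability.
Variables (G : sgraph) (C : dp_cover G).

Definition transversal (T : {set cover_graph C}) : bool :=
  [forall v : G, #|T :&: cover_list C v| == 1%N].

Definition dp_colorable : bool :=
  [exists T : {set cover_graph C}, transversal T && independent T].

End Colorability.

Section RandomCover.
Variables (G : sgraph) (k : nat).

(* Each edge is listed once, as the pair of its endpoints in increasing order
   of enumeration rank.  The orientation is arbitrary; it only serves to
   describe matchings by permutations. *)
Definition edge : finType :=
  {p : G * G | adj p.1 p.2 && (enum_rank p.1 < enum_rank p.2)%N}.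
Definition src (e : edge) : G := (val e).1.
Definition tgt (e : edge) : G := (val e).2.

(* The perfect matchings between {u} * [k] and {v} * [k] are exactly the sets
   {(u, i)(v, s i) : i in [k]}, one for each of the k! permutations s.
   The set [k] is represented by 'I_k. *)
Definition matching_family : finType := {ffun edge -> {perm 'I_k}}.

Implicit Types w : matching_family.

Definition matched w (x y : G * 'I_k) : bool :=
  [exists e : edge, [&& src e == x.1, tgt e == y.1 & w e x.2 == y.2]].

Definition random_adj w : rel (G * 'I_k)%type :=
  fun x y => matched w x y || matched w y x.

Lemma random_adj_sym w : symmetric (random_adj w).
Proof. by move=> x y; rewrite /random_adj orbC. Qed.

Lemma matched_adj w x y : matched w x y -> adj x.1 y.1.
Proof.
case/existsP=> e /and3P[/eqP <- /eqP <- _].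
by case/andP: (valP e).
Qed.

Lemma random_adj_adj w x y : random_adj w x y -> adj x.1 y.1.
Proof. by case/orP=> /matched_adj //; rewrite adj_sym. Qed.

Lemma random_adj_irrefl w : irreflexive (random_adj w).
Proof.
by move=> x; apply/negP => /random_adj_adj; rewrite adj_irrefl.
Qed.

Definition random_graph w : sgraph :=
  SGraph (random_adj_sym w) (@random_adj_irrefl w).

Definition random_list w (v : G) : {set random_graph w} :=
  [set x : G * 'I_k | x.1 == v].

Lemma random_partition w (x : random_graph w) :
  exists! v, x \in random_list w v.
Proof.
by exists x.1; split=> [|v]; rewrite inE // => /eqP.
Qed.

Lemma random_indep w v : independent (random_list w v).
Proof.
apply/forall_inP => x; rewrite inE => /eqP xv.
apply/forall_inP => y; rewrite inE => /eqP yv.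
by apply/negP => /random_adj_adj; rewrite xv yv adj_irrefl.
Qed.

Lemma random_perfect_matching w u v (x : random_graph w) :
  adj u v -> x \in random_list w u ->
  #|[set y in random_list w v | adj x y]| = 1%N.
Proof.
move=> uv; rewrite inE => /eqP xu; apply/eqP/cards1P.
have neq : u != v by apply: contraTneq uv => ->; rewrite adj_irrefl.
have [uv_lt|vu_lt|uv_eq] := ltngtP (enum_rank u) (enum_rank v); last first.
- by case/eqP: neq; apply: enum_rank_inj; apply: val_inj.
- have vuP : adj (v, u).1 (v, u).2 &&
             (enum_rank (v, u).1 < enum_rank (v, u).2)%N.
    by rewrite /= adj_sym uv vu_lt.
  exists (v, (w (Sub (v, u) vuP))^-1 x.2)%g.
  apply/setP => -[y i]; rewrite !inE /= xpair_eqE.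
  have [->|//] := eqVneq y v; rewrite /=; apply/idP/idP => [/orP[]|/eqP ->].
  + case/existsP=> -[[a b] /= p] /and3P[/=]; rewrite /src /tgt /= xu.
    move=> /eqP au /eqP bv; subst a b.
    by case/andP: (p) => _ /(ltn_trans vu_lt); rewrite ltnn.
  + case/existsP=> -[[a b] /= p] /and3P[/=]; rewrite /src /tgt /= xu.
    move=> /eqP av /eqP bu; subst a b; rewrite (bool_irrelevance p vuP).
    by move/eqP <-; rewrite permK.
  + apply/orP; right; apply/existsP; exists (Sub (v, u) vuP).
    by rewrite /src /tgt /= xu !eqxx /= permKV.
- have uvP : adj (u, v).1 (u, v).2 &&
             (enum_rank (u, v).1 < enum_rank (u, v).2)%N by rewrite /= uv uv_lt.
  exists (v, w (Sub (u, v) uvP) x.2).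
  apply/setP => -[y i]; rewrite !inE /= xpair_eqE.
  have [->|//] := eqVneq y v; rewrite /=; apply/idP/idP => [/orP[]|/eqP ->].
  + case/existsP=> -[[a b] /= p] /and3P[/=]; rewrite /src /tgt /= xu.
    move=> /eqP au /eqP bv; subst a b; rewrite (bool_irrelevance p uvP).
    by move/eqP <-.
  + case/existsP=> -[[a b] /= p] /and3P[/=]; rewrite /src /tgt /= xu.
    move=> /eqP av /eqP bu; subst a b.
    by case/andP: (p) => _ /(ltn_trans uv_lt); rewrite ltnn.
  + apply/orP; left; apply/existsP; exists (Sub (u, v) uvP).
    by rewrite /src /tgt /= xu !eqxx.
Qed.

Lemma random_matching w u v (x : random_graph w) :
  adj u v -> x \in random_list w u ->
  (#|[set y in random_list w v | adj x y]| <= 1)%N.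
Proof. by move=> uv xu; rewrite (random_perfect_matching uv xu). Qed.

Lemma random_no_other_edge w u v (x y : random_graph w) :
  x \in random_list w u -> y \in random_list w v -> adj x y -> adj u v.
Proof.
by rewrite !inE => /eqP <- /eqP <- /random_adj_adj.
Qed.

Definition random_cover w : dp_cover G :=
  DPCover (@random_partition w) (@random_indep w) (@random_matching w)
          (@random_no_other_edge w).

(* Product of the uniform laws on the k! permutations, one for each edge. *)
Definition matching_prob (R : realType) (A : {set matching_family}) : R :=
  \sum_(w in A) \prod_(e : edge) (k`!%:R)^-1.

Definition colorable_prob (R : realType) : R :=
  matching_prob R [set w | dp_colorable (random_cover w)].

End RandomCover.

Section Thresholds.
Local Open Scope classical_set_scope.
Variables (R : realType) (G : nat -> sgraph).

Definition dp_colorable_whp (kappa : nat -> nat) : Prop :=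
  colorable_prob (G l) (kappa l) R @[l --> \oo] --> (1 : R).

Definition non_dp_colorable_whp (kappa : nat -> nat) : Prop :=
  colorable_prob (G l) (kappa l) R @[l --> \oo] --> (0 : R).

Definition sharp_dp_threshold (t : nat -> R) : Prop :=
  forall (eps : R) (kappa : nat -> nat), 0 < eps ->
    ((\forall l \near \oo, (kappa l)%:R <= (1 - eps) * t l) ->
      non_dp_colorable_whp kappa) /\
    ((\forall l \near \oo, (1 + eps) * t l <= (kappa l)%:R) ->
      dp_colorable_whp kappa).

End Thresholds.

Section CompleteMultipartite.
Variables m n : nat.

Definition multipartite_adj : rel ('I_m * 'I_n)%type :=
  fun u v => u.1 != v.1.

Lemma multipartite_adj_sym : symmetric multipartite_adj.
Proof. by move=> u v; rewrite /multipartite_adj eq_sym. Qed.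

Lemma multipartite_adj_irrefl : irreflexive multipartite_adj.
Proof. by move=> u; rewrite /multipartite_adj eqxx. Qed.

Definition complete_multipartite : sgraph :=
  SGraph multipartite_adj_sym multipartite_adj_irrefl.

End CompleteMultipartite.

(* Main.v *)
Require Import Defs.
From mathcomp Require Import all_boot all_order all_algebra.
From mathcomp Require Import all_fingroup.
From mathcomp Require Import all_classical all_reals all_analysis.
From mathcomp Require Import ring lra.
Set Implicit Arguments.
Unset Strict Implicit.
Unset Printing Implicit Defensive.
Import Order.TTheory GRing.Theory Num.Theory.
Import numFieldNormedType.Exports.
Local Open Scope ring_scope.

(** Fix a graph G with N vertices and let X count the independent transversals
    of its random k-fold cover, that is, the maps f from the vertices to [k]
    that no matching sends along an edge.  Matchings on distinct edges are
    independent and a uniform permutation sends a to b with probability 1/k, so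
    E X = k^N (1 - 1/k)^|E|.

    Too few colors.  The probability of being colorable is at most E X
    ([colorable_prob_first_moment]), which for K_{m x n} is at most
    exp (m n (ln k - (m - 1) n / (2 k))).  If k <= (1 - eps) t, the subtracted
    term is at least (1 + eps) ln n whereas ln k <= ln n, so the bound tends
    to 0 ([colorable_prob_multipartite_le]).

    Enough colors.  By the inequality of Chebyshev, the probability of being
    non-colorable is at most E X^2 / (E X)^2 - 1
    ([colorable_prob_second_moment]).  Expand E X^2 over pairs (f, g) and put
    x = 1/(k - 1).  On one edge, the probability that both f and g avoid the
    matching, divided by (1 - 1/k)^2, is 1 + x when f and g agree at both ends,
    1 - x^2 when they agree at exactly one, and 1 + x^3 when they agree at none
    ([perm_mean_neq2]).  Hence E X^2 / (E X)^2 is at most (1 + x^3)^|E| times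
    the average of (1 + x)^e(S), where S is the set on which two uniform maps
    f and g agree and e(S) is the number of edges inside S.

    A given set of s vertices lies inside S with probability k^-s, and there
    are at most (e N / s)^s such sets, while 2 e(S) <= s min(s, d) if all
    degrees are at most d.  Sets of size at most a therefore contribute at most
    exp (x a^2), and those of size s > a at most
      ((e N / (s k)) exp (x min(s, d) / 2))^s,
    a geometric series with small sum as soon as the base is uniformly small
    ([colorable_prob_second_moment_bound]).  For K_{m x n} with
    k >= (1 + eps) t the choice a = (ln n)^2 works: when s <= k - 1 the
    exponential is bounded and the base is of order ln n / s; when s > k - 1,
    the degree (m - 1) n makes the exponential at most n^(1 - delta) with
    delta > 0 depending on eps, whereas N / (s k) is of order (ln n)^2 / n.
    All error terms come out as constants over ln n
    ([colorable_prob_multipartite_ge]). *)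

(** * Uniform random permutations *)

Section UniformPermutation.
Variables (R : realType) (k : nat).
Implicit Types F : {perm 'I_k} -> R.
Implicit Types a b c d : 'I_k.

Definition perm_mean F : R := (k`!%:R)^-1 * \sum_s F s.

Lemma perm_mean_const (r : R) : perm_mean (fun=> r) = r.
Proof.
rewrite /perm_mean sumr_const card_Sn -[X in _ * X]mulr_natl mulrA.
by rewrite mulVf ?mul1r // pnatr_eq0 -lt0n fact_gt0.
Qed.

Lemma perm_meanD F1 F2 :
  perm_mean (fun s => F1 s + F2 s) = perm_mean F1 + perm_mean F2.
Proof. by rewrite /perm_mean big_split mulrDr. Qed.

Lemma perm_meanB F1 F2 :
  perm_mean (fun s => F1 s - F2 s) = perm_mean F1 - perm_mean F2.
Proof. by rewrite /perm_mean sumrB mulrBr. Qed.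

Lemma perm_mean_sum (I : finType) (A : pred I) (F : I -> {perm 'I_k} -> R) :
  perm_mean (fun s => \sum_(i | A i) F i s) = \sum_(i | A i) perm_mean (F i).
Proof. by rewrite /perm_mean exchange_big /= mulr_sumr. Qed.

Lemma eq_perm_mean F1 F2 : F1 =1 F2 -> perm_mean F1 = perm_mean F2.
Proof. by move=> eqF; rewrite /perm_mean (eq_bigr _ (fun s _ => eqF s)). Qed.

Lemma perm_mean_mulg F (t : {perm 'I_k}) :
  perm_mean (fun s => F (s * t)%g) = perm_mean F.
Proof.
rewrite /perm_mean; congr (_ * _).
by rewrite [RHS](reindex_inj (mulIg t)).
Qed.

Lemma sum_pred1_natr (I : finType) (A : pred I) (i : I) :
  \sum_(j | A j) (i == j)%:R = (A i)%:R :> R.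
Proof.
case: (boolP (A i)) => Ai.
  rewrite (bigD1 i) //= eqxx big1 ?addr0 // => j /andP[_ /negbTE ji].
  by rewrite eq_sym ji.
by rewrite big1 // => j Aj; case: eqP => // ij; rewrite ij Aj in Ai.
Qed.

(** Composing with a transposition of two values shows that all k values of
    s a are equally likely. *)
Lemma perm_mean_eq a b : perm_mean (fun s => (s a == b)%:R) = k%:R^-1.
Proof.
have k_gt0 : k%:R != 0 :> R by rewrite pnatr_eq0 -lt0n (leq_ltn_trans _ (ltn_ord a)).
have sym c : perm_mean (fun s => (s a == c)%:R) = perm_mean (fun s => (s a == b)%:R).
  rewrite -(perm_mean_mulg _ (tperm b c)); apply: eq_perm_mean => s.
  by rewrite permM -(inj_eq (@perm_inj _ (tperm b c))) tpermK tpermR.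
have : \sum_c perm_mean (fun s => (s a == c)%:R) = 1.
  rewrite -perm_mean_sum -[RHS]perm_mean_const; apply: eq_perm_mean => s.
  by rewrite sum_pred1_natr.
under eq_bigr do rewrite sym.
rewrite sumr_const card_ord -[LHS]mulr_natl => H.
by apply: (mulfI k_gt0); rewrite H divff.
Qed.

(** Given s a = b, composing with transpositions that fix b shows that the
    k - 1 other values of s c are equally likely. *)
Lemma perm_mean_eq2 a b c d : a != c -> b != d ->
  perm_mean (fun s => ((s a == b) && (s c == d))%:R) = (k%:R * (k%:R - 1))^-1.
Proof.
move=> ac bd.
have k_gt1 : (1 < k)%N.
  by rewrite -[k]card_ord; apply/card_gt1P; exists a, c.
have k1 : k%:R - 1 != 0 :> R.
  by rewrite -(natrB _ (ltnW k_gt1)) pnatr_eq0 -lt0n subn_gt0.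
have sym e : b != e ->
  perm_mean (fun s => ((s a == b) && (s c == e))%:R) =
  perm_mean (fun s => ((s a == b) && (s c == d))%:R).
  move=> be; rewrite -(perm_mean_mulg _ (tperm d e)); apply: eq_perm_mean => s.
  rewrite !permM -[s a == b](inj_eq (@perm_inj _ (tperm d e))).
  rewrite -[s c == d](inj_eq (@perm_inj _ (tperm d e))) tpermL.
  by rewrite (@tpermD _ _ _ b) // eq_sym.
have : \sum_(e | b != e) perm_mean (fun s => ((s a == b) && (s c == e))%:R)
      = k%:R^-1.
  rewrite -perm_mean_sum -(perm_mean_eq a b); apply: eq_perm_mean => s.
  case: eqP => [sab|] /=; last by rewrite big1.
  rewrite sum_pred1_natr -sab (inj_eq perm_inj) ac //.
rewrite (eq_bigr _ sym) sumr_const.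
have -> : #|[pred e | b != e]| = (k - 1)%N.
  rewrite -[k in RHS]card_ord subn1 -(cardC1 b).
  by apply: eq_card => e; rewrite !inE eq_sym.
rewrite -[LHS]mulr_natl natrB ?(ltnW k_gt1) // => H.
by apply: (mulfI k1); rewrite H invfM mulrCA divff ?mulr1.
Qed.

Lemma perm_mean_neq a b : perm_mean (fun s => (s a != b)%:R) = 1 - k%:R^-1.
Proof.
rewrite -(perm_mean_eq a b) -[X in X - _]perm_mean_const -perm_meanB.
by apply: eq_perm_mean => s; case: eqP; rewrite ?subr0 ?subrr.
Qed.

(** With x = 1/(k - 1), the quotient of the left-hand side by (1 - 1/k)^2 is
    1 + x, 1 - x^2 or 1 + x^3 according to whether both, exactly one or none of
    a = c and b = d holds; the stated form is a common upper bound that splits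
    as a product over the edges. *)
Lemma perm_mean_neq2 a b c d : (1 < k)%N ->
  perm_mean (fun s => (s a != b)%:R * (s c != d)%:R) <=
  (1 - k%:R^-1) ^+ 2 * ((1 + (k%:R - 1)^-1 ^+ 3) *
    (if (a == c) && (b == d) then 1 + (k%:R - 1)^-1 else 1)).
Proof.
move=> k_gt1; set x := (_ - 1)^-1.
have q1 : 1 < k%:R :> R by rewrite ltr1n.
have x_gt0 : 0 < x by rewrite invr_gt0 subr_gt0.
have x3 : 1 <= 1 + x ^+ 3 by rewrite lerDl exprn_ge0 // ltW.
have kx : k%:R^-1 = x / (1 + x) :> R.
  by rewrite /x; field; apply/andP; split; apply: lt0r_neq0; lra.
have -> : perm_mean (fun s => (s a != b)%:R * (s c != d)%:R) =
  1 - k%:R^-1 - k%:R^-1 + perm_mean (fun s => ((s a == b) && (s c == d))%:R).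
  rewrite -[X in 1 - X](perm_mean_eq a b) -[X in _ - X](perm_mean_eq c d).
  rewrite -[X in X - _ - _](perm_mean_const 1).
  rewrite -!perm_meanB -perm_meanD; apply: eq_perm_mean => s.
  by case: (s a == b); case: (s c == d) => /=; ring.
have weaken y z : 0 <= z -> y <= z -> y <= z * (1 + x ^+ 3).
  by move=> z_ge0 yz; rewrite (le_trans yz) // ler_peMr.
have kx1 : 0 <= 1 - k%:R^-1 :> R by rewrite subr_ge0 invf_le1 ?ltW //; lra.
have [ac|ac] := eqVneq a c; have [bd|bd] := eqVneq b d => /=; rewrite ?mulr1.
- rewrite -ac -bd.
  rewrite mulrCA mulrC; apply: weaken; first by rewrite mulr_ge0 ?sqr_ge0 //; lra.
  have -> : perm_mean (fun s => ((s a == b) && (s a == b))%:R) = k%:R^-1.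
    by rewrite -(perm_mean_eq a b); apply: eq_perm_mean => s; rewrite andbb.
  rewrite kx le_eqVlt; apply/orP; left; apply/eqP; field; apply: lt0r_neq0; lra.
- rewrite -ac; apply: weaken; first exact: sqr_ge0.
  have -> : perm_mean (fun s => ((s a == b) && (s a == d))%:R) = 0.
    rewrite -[RHS](perm_mean_const 0); apply: eq_perm_mean => s.
    by case: eqP => //= ->; rewrite (negbTE bd).
  have := sqr_ge0 (k%:R^-1 : R); nra.
- rewrite -bd; apply: weaken; first exact: sqr_ge0.
  have -> : perm_mean (fun s => ((s a == b) && (s c == b))%:R) = 0.
    rewrite -[RHS](perm_mean_const 0); apply: eq_perm_mean => s.
    by case: eqP => //= <-; rewrite (inj_eq perm_inj) eq_sym (negbTE ac).
  have := sqr_ge0 (k%:R^-1 : R); nra.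
- rewrite perm_mean_eq2 // invfM -/x kx le_eqVlt; apply/orP; left; apply/eqP.
  by field; apply: lt0r_neq0; lra.
Qed.

End UniformPermutation.

(** * First and second moments of the number of colorings *)

Section Colorings.
Variables (G : sgraph) (k : nat).
Implicit Types (f g : {ffun G -> 'I_k}) (w : matching_family G k).

Definition proper_coloring f w : bool :=
  [forall e : edge G, w e (f (src e)) != f (tgt e)].

(** An independent transversal is the graph of a coloring that avoids every
    matching. *)
Lemma random_cover_colorableE w :
  dp_colorable (random_cover w) = [exists f, proper_coloring f w].
Proof.
apply/existsP/existsP => [[T /andP[/forallP trT /forall_inP indT]]|[f /forallP fP]].
  have /fin_all_exists[f fT] v : exists i : 'I_k, (v, i) \in T.
    have /cards1P[[u i] /setP/(_ (u, i))] := trT v.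
    rewrite !inE /= eqxx => /andP[uiT /eqP uv].
    by exists i; rewrite -uv.
  exists (finfun f); apply/forallP => e; rewrite !ffunE.
  have /forall_inP/(_ (tgt e, f (tgt e)) (fT _)) := indT (src e, f (src e)) (fT _).
  apply: contraNneq => we; apply/orP; left; apply/existsP; exists e.
  by rewrite /= !eqxx /= we.
exists [set x : G * 'I_k | x.2 == f x.1]; apply/andP; split.
  apply/forallP => v; apply/cards1P; exists (v, f v); apply/setP => -[u i].
  rewrite !inE /= xpair_eqE andbC.
  by have [->|] := eqVneq u v.
have unmatched (x y : G * 'I_k) : x.2 == f x.1 -> y.2 == f y.1 -> ~~ matched w x y.
  move=> /eqP fx /eqP fy; apply/existsP => -[e /and3P[/eqP sx /eqP ty /eqP]].
  by rewrite fx fy -sx -ty; apply/eqP.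
apply/forall_inP => x; rewrite inE => fx; apply/forall_inP => y; rewrite inE => fy.
by apply/norP; split; apply: unmatched.
Qed.

Variable R : realType.

Definition cover_mean (F : matching_family G k -> R) : R :=
  (\prod_(e : edge G) (k`!%:R)^-1) * \sum_w F w.

Lemma eq_cover_mean F1 F2 : F1 =1 F2 -> cover_mean F1 = cover_mean F2.
Proof. by move=> eqF; rewrite /cover_mean (eq_bigr _ (fun w _ => eqF w)). Qed.

Lemma ler_cover_mean F1 F2 :
  (forall w, F1 w <= F2 w) -> cover_mean F1 <= cover_mean F2.
Proof.
move=> leF; rewrite /cover_mean ler_wpM2l //; last exact: ler_sum.
by apply: prodr_ge0 => e _; rewrite invr_ge0.
Qed.

Lemma cover_meanD F1 F2 :
  cover_mean (fun w => F1 w + F2 w) = cover_mean F1 + cover_mean F2.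
Proof. by rewrite /cover_mean big_split mulrDr. Qed.

Lemma cover_meanB F1 F2 :
  cover_mean (fun w => F1 w - F2 w) = cover_mean F1 - cover_mean F2.
Proof. by rewrite /cover_mean sumrB mulrBr. Qed.

Lemma cover_meanZ (r : R) F : cover_mean (fun w => r * F w) = r * cover_mean F.
Proof. by rewrite /cover_mean -mulr_sumr mulrCA. Qed.

Lemma cover_mean_sum (I : finType) (F : I -> matching_family G k -> R) :
  cover_mean (fun w => \sum_i F i w) = \sum_i cover_mean (F i).
Proof. by rewrite /cover_mean exchange_big /= mulr_sumr. Qed.

(** The independence of the matchings on distinct edges. *)
Lemma cover_mean_prod (F : edge G -> {perm 'I_k} -> R) :
  cover_mean (fun w => \prod_e F e (w e)) = \prod_e perm_mean (F e).
Proof. by rewrite /cover_mean /perm_mean big_split /= bigA_distr_bigA. Qed.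

Lemma cover_mean_const (r : R) : cover_mean (fun=> r) = r.
Proof.
have := cover_mean_prod (fun _ _ => 1).
under [LHS]eq_cover_mean do rewrite big1_eq.
under [RHS]eq_bigr do rewrite perm_mean_const.
rewrite big1_eq => mean1.
rewrite -[RHS]mulr1 -mean1 -cover_meanZ; apply: eq_cover_mean => w.
by rewrite mulr1.
Qed.

Lemma colorable_probE :
  colorable_prob G k R = cover_mean (fun w => [exists f, proper_coloring f w]%:R).
Proof.
rewrite /colorable_prob /matching_prob sumr_const -[LHS]mulr_natr.
congr (_ * _); rewrite -sum1_card natr_sum big_mkcond /=.
apply: eq_bigr => w _; rewrite inE random_cover_colorableE.
by case: ifP.
Qed.

Lemma colorable_prob_ge0 : 0 <= colorable_prob G k R.
Proof.
rewrite colorable_probE -[leLHS](cover_mean_const 0).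
by apply: ler_cover_mean => w; rewrite ler0n.
Qed.

Lemma colorable_prob_le1 : colorable_prob G k R <= 1.
Proof.
rewrite colorable_probE -[leRHS](cover_mean_const 1).
by apply: ler_cover_mean => w; rewrite (ler_nat R _ 1) leq_b1.
Qed.

Definition colorings w : R := \sum_f (proper_coloring f w)%:R.

Lemma proper_coloring_prod f w :
  (proper_coloring f w)%:R = \prod_e (w e (f (src e)) != f (tgt e))%:R :> R.
Proof.
have [/forallP fP|/forallPn[e /negPn/eqP we]] := boolP (proper_coloring f w).
  by rewrite big1 // => e _; rewrite fP.
by rewrite (bigD1 e) //= we eqxx mul0r.
Qed.

Lemma mean_colorings :
  cover_mean colorings = k%:R ^+ #|G| * (1 - k%:R^-1) ^+ #|edge G|.
Proof.
have mean_proper f : cover_mean (fun w => (proper_coloring f w)%:R) =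
    (1 - k%:R^-1) ^+ #|edge G|.
  under eq_cover_mean do rewrite proper_coloring_prod.
  rewrite (cover_mean_prod (fun e s => (s (f (src e)) != f (tgt e))%:R)).
  by under eq_bigr do rewrite perm_mean_neq; rewrite prodr_const.
rewrite cover_mean_sum (eq_bigr _ (fun f _ => mean_proper f)) sumr_const.
by rewrite card_ffun card_ord -natrX mulr_natl.
Qed.

Lemma colorable_prob_first_moment :
  colorable_prob G k R <= k%:R ^+ #|G| * (1 - k%:R^-1) ^+ #|edge G|.
Proof.
rewrite colorable_probE -mean_colorings; apply: ler_cover_mean => w.
case: existsP => [[f fP]|_]; last by apply: sumr_ge0 => f _; exact: ler0n.
rewrite /colorings (bigD1 f) //= fP lerDl.
by apply: sumr_ge0 => g _; exact: ler0n.
Qed.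

(** The inequality of Chebyshev for Y = colorings / mu, in the form
    1[Y = 0] <= (Y - 1)^2, together with E (Y - 1)^2 = E Y^2 - 1. *)
Lemma colorable_prob_second_moment (mu := cover_mean colorings) : mu != 0 ->
  1 - colorable_prob G k R <=
  cover_mean (fun w => colorings w ^+ 2) / mu ^+ 2 - 1.
Proof.
move=> mu0.
have -> : cover_mean (fun w => colorings w ^+ 2) / mu ^+ 2 - 1 =
    cover_mean (fun w => (colorings w / mu - 1) ^+ 2).
  have -> : cover_mean (fun w => (colorings w / mu - 1) ^+ 2) =
     cover_mean (fun w => (mu ^- 2) * (colorings w ^+ 2) +
                          ((- 2 / mu) * colorings w + 1)).
    by apply: eq_cover_mean => w; field.
  by rewrite !cover_meanD !cover_meanZ cover_mean_const -/mu; field.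
rewrite colorable_probE -[X in X - _ <= _](cover_mean_const 1) -cover_meanB.
apply: ler_cover_mean => w.
case: existsP => [_|noP]; first by rewrite subrr sqr_ge0.
rewrite subr0 /colorings big1 ?mul0r ?sub0r ?sqrrN ?expr1n // => f _.
by case: (boolP (proper_coloring f w)) => // fP; case: noP; exists f.
Qed.

Definition agreement f g : {set G} := [set v | f v == g v].

Definition inner_edges (S : {set G}) : {set edge G} :=
  [set e | (src e \in S) && (tgt e \in S)].

(** An edge receives the factor 1 + x only when both of its ends lie in the
    agreement set, so these factors multiply up to (1 + x)^e(S). *)
Lemma mean_colorings_sqr (x := (k%:R - 1)^-1) : (1 < k)%N ->
  cover_mean (fun w => colorings w ^+ 2) <=
  (1 - k%:R^-1) ^+ #|edge G| ^+ 2 * (1 + x ^+ 3) ^+ #|edge G| *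
    \sum_f \sum_g (1 + x) ^+ #|inner_edges (agreement f g)|.
Proof.
move=> k_gt1.
have -> : cover_mean (fun w => colorings w ^+ 2) =
  \sum_(f : {ffun G -> 'I_k}) \sum_(g : {ffun G -> 'I_k}) \prod_(e : edge G)
    perm_mean (fun s => (s (f (src e)) != f (tgt e))%:R *
                        (s (g (src e)) != g (tgt e))%:R).
  transitivity (\sum_f \sum_g cover_mean (fun w =>
     (proper_coloring f w)%:R * (proper_coloring g w)%:R)).
    under [RHS]eq_bigr do rewrite -cover_mean_sum.
    rewrite -cover_mean_sum; apply: eq_cover_mean => w.
    rewrite expr2 /colorings mulr_suml; apply: eq_bigr => f _.
    by rewrite mulr_sumr.
  apply: eq_bigr => f _; apply: eq_bigr => g _.
  rewrite -(cover_mean_prod (fun e s => (s (f (src e)) != f (tgt e))%:R *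
                        (s (g (src e)) != g (tgt e))%:R)).
  by apply: eq_cover_mean => w; rewrite !proper_coloring_prod big_split.
rewrite mulr_sumr; apply: ler_sum => f _.
rewrite mulr_sumr; apply: ler_sum => g _.
rewrite -exprM mulnC exprM -exprMn -[_ ^+ #|inner_edges _|]prodr_const.
rewrite -[_ ^+ #|edge G|]prodr_const [X in _ * X]big_mkcond -big_split /=.
apply: ler_prod => e _; apply/andP; split.
  rewrite /perm_mean mulr_ge0 ?invr_ge0 ?ler0n //.
  by apply: sumr_ge0 => s _; rewrite mulr_ge0 ?ler0n.
by rewrite -mulrA !inE; exact: perm_mean_neq2.
Qed.

End Colorings.

(** * Counting: inner edges, binomials, agreement sets *)

Section InnerEdges.
Variable G : sgraph.
Implicit Types S : {set G}.

(** The ordered pairs of adjacent vertices of S fall into two classes, those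
    in increasing and those in decreasing order of rank; each is in bijection
    with the edges inside S. *)
Lemma handshake_inner S :
  (#|inner_edges S|.*2 = \sum_(u in S) #|[set v in S | adj u v]|)%N.
Proof.
pose A := [set p : G * G | (p.1 \in S) && ((p.2 \in S) && adj p.1 p.2)].
pose B := [set p : G * G | (enum_rank p.1 < enum_rank p.2)%N].
have -> : (\sum_(u in S) #|[set v in S | adj u v]| = #|A|)%N.
  rewrite -sum1_card; under eq_bigr do rewrite -sum1_card.
  rewrite pair_big_dep /=; apply: eq_bigl => p; by rewrite !inE.
have innerE : #|inner_edges S| = #|A :&: B|.
  rewrite -(card_imset _ val_inj); apply: eq_card => p.
  apply/imsetP/idP => [[e eS ->]|].
    move: eS; rewrite !inE /src /tgt => /andP[-> ->].
    by case/andP: (valP e) => -> ->.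
  rewrite !inE -!andbA => /and4P[uS vS uv lt_uv].
  have pP : adj p.1 p.2 && (enum_rank p.1 < enum_rank p.2)%N by rewrite uv.
  by exists (Sub p pP : edge G); rewrite ?SubK // inE /src /tgt SubK uS.
have swap_inj : injective (fun p : G * G => (p.2, p.1)).
  by move=> [u v] [u' v'] [-> ->].
rewrite -(cardsID B A) -addnn innerE; congr (_ + _)%N.
rewrite -(card_imset _ swap_inj); apply: eq_card => -[u v].
apply/imsetP/idP => [[[u' v']]|].
  rewrite !inE /= => /andP[/and3P[uS vS uv] lt_uv] [-> ->].
  by rewrite uS vS adj_sym uv -leqNgt ltnW.
rewrite !inE /= -leqNgt => /andP[le_vu /and3P[uS vS uv]].
exists (v, u) => //; rewrite !inE /= uS vS adj_sym uv /= ltn_neqAle le_vu andbT.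
by apply: contraTneq uv => /val_inj/enum_rank_inj ->; rewrite adj_irrefl.
Qed.

Lemma inner_edgesT : #|inner_edges [set: G]| = #|edge G|.
Proof. by apply: eq_card => e; rewrite !inE. Qed.

Lemma inner_edges_le S d : (forall u : G, #|[set v | adj u v]| <= d)%N ->
  (#|inner_edges S|.*2 <= #|S| * minn #|S| d)%N.
Proof.
move=> le_d; rewrite handshake_inner -sum_nat_const; apply: leq_sum => u _.
rewrite leq_min; apply/andP; split.
  by apply: subset_leq_card; apply/fintype.subsetP => v; rewrite !inE => /andP[].
apply: leq_trans (le_d u); apply: subset_leq_card.
by apply/fintype.subsetP => v; rewrite !inE => /andP[].
Qed.

End InnerEdges.

Section Estimates.
Variable R : realType.

(** Combines C(n, s) <= n^s / s! with s^s / s! <= exp s, a term of the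
    exponential series. *)
Lemma bin_le_expR n s : (0 < s)%N ->
  'C(n, s)%:R <= (expR 1 * n%:R / s%:R) ^+ s :> R.
Proof.
move=> s_gt0.
have s_gt0R : 0 < s%:R :> R by rewrite ltr0n.
have f_gt0 : 0 < s`!%:R :> R by rewrite ltr0n fact_gt0.
have ffact_le : (n ^_ s <= n ^ s)%N.
  rewrite ffact_prod -[X in (_ <= _ ^ X)%N]card_ord -prod_nat_const.
  by apply: leq_prod => i _; exact: leq_subr.
have bin_le : 'C(n, s)%:R <= n%:R ^+ s / s`!%:R :> R.
  by rewrite ler_pdivlMr // -natrM bin_ffact -natrX ler_nat.
have pow_le : s%:R ^+ s / s`!%:R <= expR 1 ^+ s :> R.
  rewrite -expRM_natl mulr1; case: s s_gt0 {bin_le ffact_le s_gt0R f_gt0} => // s _.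
  by apply: le_trans (expR_ge1Dxn s (ler0n _ s.+1)); rewrite lerDr.
apply: (le_trans bin_le).
have -> : (expR 1 * n%:R / s%:R) ^+ s = n%:R ^+ s * (expR 1 ^+ s / s%:R ^+ s) :> R.
  by rewrite !exprMn exprVn; ring.
by rewrite ler_wpM2l // ler_pdivlMr ?exprn_gt0 // mulrC.
Qed.

Lemma sum_expr_le2 (b : R) n : 0 <= b <= 2^-1 ->
  \sum_(i < n) b ^+ i.+1 <= 2 * b.
Proof.
move=> /andP[b0 b2].
have -> : \sum_(i < n) b ^+ i.+1 = b * \sum_(i < n) b ^+ i.
  by rewrite mulr_sumr; apply: eq_bigr => i _; rewrite exprS.
rewrite mulrC ler_wpM2r //.
have geo : (1 - b) * \sum_(i < n) b ^+ i = 1 - b ^+ n.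
  rewrite -{2}(expr1n R n) subrXX; congr (_ * _); apply: eq_bigr => i _.
  by rewrite expr1n mul1r.
have := exprn_ge0 n b0; have : 0 <= \sum_(i < n) b ^+ i.
  by apply: sumr_ge0 => i _; rewrite exprn_ge0.
nra.
Qed.

End Estimates.

Section AgreementSum.
Variables (R : realType) (G : sgraph) (k : nat).
Implicit Types (f g : {ffun G -> 'I_k}) (S : {set G}).
Hypothesis k_gt0 : (0 < k)%N.

(** Two independent uniform maps agree on all of S with probability k^-|S|. *)
Lemma sum_subset_agreement S :
  \sum_(f : {ffun G -> 'I_k}) \sum_(g : {ffun G -> 'I_k})
      (S \subset agreement f g)%:R
    = (k%:R ^+ #|G|) ^+ 2 * k%:R^-1 ^+ #|S| :> R.
Proof.
have k0 : k%:R != 0 :> R by rewrite pnatr_eq0 -lt0n.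
have sum_g f : \sum_(g : {ffun G -> 'I_k}) (S \subset agreement f g)%:R
    = k%:R ^+ #|G| * k%:R^-1 ^+ #|S| :> R.
  transitivity (\sum_(g : {ffun G -> 'I_k})
      \prod_v (if v \in S then (f v == g v)%:R else 1) : R).
    apply: eq_bigr => g _; have [/fintype.subsetP sub|/fintype.subsetPn[v vS vN]] := boolP (_ \subset _).
      rewrite big1 // => v _; case: ifP => // /sub.
      by rewrite inE => ->.
    by rewrite (bigD1 v) //= vS; move: vN; rewrite inE => /negbTE ->; rewrite mul0r.
  rewrite -(bigA_distr_bigA (fun v i => if v \in S then (f v == i)%:R else 1)).
  transitivity (\prod_(v : G) (k%:R * (if v \in S then k%:R^-1 else 1)) : R).
    apply: eq_bigr => v _; case: ifP => _.
      by rewrite (sum_pred1_natr _ predT) divff.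
    by rewrite sumr_const card_ord mulr1.
  by rewrite big_split /= prodr_const -big_mkcond prodr_const.
rewrite (eq_bigr _ (fun f _ => sum_g f)) sumr_const card_ffun card_ord.
by rewrite -[LHS]mulr_natl natrX mulrA -expr2.
Qed.

End AgreementSum.

(** * The second moment bound for graphs of bounded degree *)

Section SecondMoment.
Variables (R : realType) (G : sgraph) (k d : nat) (a b : R).
Hypothesis k_gt1 : (1 < k)%N.
Hypothesis degree_le : forall u : G, (#|[set v | adj u v]| <= d)%N.
Hypothesis a_ge0 : 0 <= a.
Hypothesis b_bounds : 0 <= b <= 2^-1.

Let x : R := (k%:R - 1)^-1.
Let N := #|G|.

(* The base of the geometric series that bounds the sets of size s > a. *)
Hypothesis tail_le : forall s, a < s%:R -> (s <= N)%N ->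
  expR 1 * N%:R / (s%:R * k%:R) * expR (x * (minn s d)%:R / 2) <= b.

Let x_ge0 : 0 <= x.
Proof. by rewrite invr_ge0 subr_ge0 ler1n ltnW. Qed.

Let weight (s : nat) : R := expR (x * (minn s d)%:R / 2) ^+ s.

Lemma inner_edges_weight (S : {set G}) :
  (1 + x) ^+ #|inner_edges S| <= weight #|S|.
Proof.
apply: (@le_trans _ _ (expR (x * #|inner_edges S|%:R))).
  rewrite mulrC expRM_natl lerXn2r ?nnegrE ?expR_ge0 ?addr_ge0 //.
  exact: expR_ge1Dx.
rewrite /weight -expRM_natl ler_expR -mulrA mulrCA ler_wpM2l //.
have := inner_edges_le S degree_le; rewrite -(ler_nat R) natrM -muln2 natrM.
set e := _%:R; set t := #|S|%:R; lra.
Qed.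

(** The minimum is at most s here: the trivial bound of s^2 / 2 edges inside a
    set of size s is enough for small agreement sets. *)
Lemma small_weight s : s%:R <= a -> weight s <= expR (x * a ^+ 2).
Proof.
move=> sa; rewrite /weight -expRM_natl ler_expR -mulrA mulrCA ler_wpM2l //.
have le_min : (minn s d)%:R <= s%:R :> R by rewrite ler_nat geq_minl.
have := ler0n R s; have := ler0n R (minn s d); nra.
Qed.

(** The union bound over large candidate agreement sets, grouped by size: the
    sets of size s contribute at most b^s. *)
Lemma large_weight :
  \sum_(S : {set G} | a < #|S|%:R) weight #|S| * k%:R^-1 ^+ #|S| <= 2 * b.
Proof.
have cardN (S : {set G}) : #|S| = (inord #|S| : 'I_N.+1).
  by rewrite inordK // ltnS; exact: max_card.
rewrite (partition_big (fun S : {set G} => inord #|S| : 'I_N.+1)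
   (fun s => a < s%:R)) /=; last by move=> S; rewrite {1}cardN.
have bound (s : 'I_N.+1) : a < s%:R ->
  \sum_(S : {set G} | (a < #|S|%:R) && (inord #|S| == s))
    weight #|S| * k%:R^-1 ^+ #|S| <= b ^+ s.
  move=> a_lt_s.
  have s_gt0 : (0 < s)%N by rewrite -(ltr_nat R) (le_lt_trans a_ge0).
  rewrite (eq_bigr (fun=> weight s * k%:R^-1 ^+ s)); last first.
    by move=> S /andP[_ /eqP <-]; rewrite -cardN.
  rewrite sumr_const.
  have -> : #|[pred S : {set G} | (a < #|S|%:R) && (inord #|S| == s)]| = 'C(N, s).
    rewrite -card_draws -cardsE; apply: eq_card => S; rewrite !inE -val_eqE /= -cardN.
    by case: (#|S| =P s) => [->|]; rewrite ?andbF // a_lt_s.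
  rewrite -[leLHS]mulr_natl.
  apply: le_trans (ler_wpM2r _ (bin_le_expR R N s_gt0)) _.
    by rewrite mulr_ge0 ?exprn_ge0 ?invr_ge0 ?expR_ge0.
  have b_ge0 : 0 <= b by case/andP: b_bounds.
  rewrite /weight -!exprMn lerXn2r ?nnegrE //.
  apply: le_trans (tail_le a_lt_s _); last by rewrite -ltnS.
  by set E := expR (x * _ / 2); rewrite invfM -!mulrA (mulrC E).
apply: le_trans (ler_sum _ bound) _.
apply: le_trans (sum_expr_le2 N b_bounds).
have b_ge0 : 0 <= b by case/andP: b_bounds.
rewrite big_mkcond big_ord_recl /= ltNge a_ge0 /= add0r; apply: ler_sum => i _.
by case: ifP => _; rewrite /bump //= exprn_ge0.
Qed.

(** Either the agreement set is small, or it is itself one of the large sets S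
    in the sum of [large_weight]; this reduces the sum over pairs (f, g) to a
    sum over S. *)
Lemma sum_agreement_le :
  \sum_(f : {ffun G -> 'I_k}) \sum_(g : {ffun G -> 'I_k})
      (1 + x) ^+ #|inner_edges (agreement f g)|
    <= (k%:R ^+ N) ^+ 2 * (expR (x * a ^+ 2) + 2 * b).
Proof.
have pointwise (f g : {ffun G -> 'I_k}) : (1 + x) ^+ #|inner_edges (agreement f g)| <=
    expR (x * a ^+ 2) + \sum_(S : {set G} | a < #|S|%:R)
      weight #|S| * (S \subset agreement f g)%:R.
  have weight_ge0 (P : pred {set G}) :
      0 <= \sum_(S : {set G} | P S) weight #|S| * (S \subset agreement f g)%:R.
    by apply: sumr_ge0 => S _; rewrite mulr_ge0 ?exprn_ge0 ?expR_ge0.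
  apply: (le_trans (inner_edges_weight _)).
  have [small|large] := leP #|agreement f g|%:R a.
    by apply: (le_trans (small_weight small)); rewrite lerDl.
  rewrite (bigD1 (agreement f g)) //= fintype.subxx mulr1.
  by rewrite addrCA lerDl addr_ge0 ?expR_ge0.
apply: (@le_trans _ _ (\sum_(f : {ffun G -> 'I_k}) \sum_(g : {ffun G -> 'I_k})
   (expR (x * a ^+ 2) + \sum_(S : {set G} | a < #|S|%:R)
      weight #|S| * (S \subset agreement f g)%:R))).
  by apply: ler_sum => f _; apply: ler_sum => g _; exact: pointwise.
under eq_bigr do rewrite big_split /= sumr_const card_ffun card_ord.
rewrite big_split /= sumr_const card_ffun card_ord mulrDr; apply: lerD.
  by rewrite -mulrnA -[leLHS]mulr_natl natrM natrX expr2.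
under eq_bigr do rewrite exchange_big /=.
rewrite exchange_big /=.
rewrite (eq_bigr (fun S : {set G} =>
    (k%:R ^+ N) ^+ 2 * (weight #|S| * k%:R^-1 ^+ #|S|))); last first.
  move=> S _; rewrite mulrCA -(sum_subset_agreement _ (ltnW k_gt1)) mulr_sumr.
  by apply: eq_bigr => f _; rewrite mulr_sumr.
by rewrite -mulr_sumr ler_wpM2l ?sqr_ge0 // large_weight.
Qed.

(** The factor exp (N^2 x^3) is a crude bound, with N^2 >= |E|, on the product
    of the factors 1 + x^3 over the edges. *)
Lemma colorable_prob_second_moment_bound :
  1 - colorable_prob G k R <=
  expR (N%:R ^+ 2 * x ^+ 3) * (expR (x * a ^+ 2) + 2 * b) - 1.
Proof.
have k1 : 1 < k%:R :> R by rewrite ltr1n.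
have q_gt0 : 0 < 1 - k%:R^-1 :> R by rewrite subr_gt0 invf_lt1 // (lt_trans ltr01).
have mu_gt0 : 0 < cover_mean (@colorings G k R).
  by rewrite mean_colorings mulr_gt0 ?exprn_gt0 // (lt_trans ltr01).
apply: le_trans (colorable_prob_second_moment (lt0r_neq0 mu_gt0)) _.
rewrite lerD2r ler_pdivrMr ?exprn_gt0 //.
apply: (le_trans (mean_colorings_sqr G R k_gt1)).
rewrite mean_colorings -/x.
have edges_le : (1 + x ^+ 3) ^+ #|edge G| <= expR (N%:R ^+ 2 * x ^+ 3).
  have x3 : 0 <= x ^+ 3 by rewrite exprn_ge0.
  apply: (@le_trans _ _ (expR (x ^+ 3) ^+ #|edge G|)).
    by rewrite lerXn2r ?nnegrE ?expR_ge0 ?addr_ge0 //; exact: expR_ge1Dx.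
  rewrite -expRM_natl ler_expR ler_wpM2r // -natrX ler_nat -mulnn.
  by rewrite -card_prod; exact: leq_card val_inj.
rewrite -[leLHS]mulrA exprMn mulrC -[leLHS]mulrA.
have -> : forall e c p q : R, e * c * (p * q) = e * (p * c * q).
  by move=> e c p q; ring.
apply: ler_pM edges_le _; last first.
- by rewrite ler_wpM2r ?sqr_ge0 ?sum_agreement_le.
- rewrite mulr_ge0 ?sqr_ge0 //.
  by do 2![apply: sumr_ge0 => ? _]; rewrite exprn_ge0 ?addr_ge0.
- by rewrite exprn_ge0 // addr_ge0 ?exprn_ge0.
Qed.

End SecondMoment.

(** * Complete multipartite graphs: too few colors *)

Section CompleteMultipartiteGraph.
Variables m n : nat.

Lemma card_complete_multipartite : #|complete_multipartite m n| = (m * n)%N.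
Proof. by rewrite card_prod !card_ord. Qed.

Lemma degree_complete_multipartite (u : complete_multipartite m n) :
  #|[set v | adj u v]| = (m.-1 * n)%N.
Proof.
have -> : [set v | adj u v] = finset.setX [set~ u.1] [set: 'I_n].
  by apply/setP => v; rewrite !inE andbT eq_sym.
by rewrite cardsX cardsC1 cardsT !card_ord.
Qed.

Lemma card_edge_complete_multipartite :
  (#|edge (complete_multipartite m n)|.*2 = m * n * (m.-1 * n))%N.
Proof.
rewrite -inner_edgesT handshake_inner.
rewrite (eq_bigr (fun=> m.-1 * n)%N).
  by rewrite sum_nat_const cardsT card_complete_multipartite.
move=> u _; rewrite -(degree_complete_multipartite u).
by apply: eq_card => v; rewrite !inE.
Qed.

End CompleteMultipartiteGraph.

Section Bounds.
Variables (R : realType) (m : nat).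
Hypothesis m_ge2 : (2 <= m)%N.

Let m_ge2R : 2 <= m%:R :> R.
Proof. by rewrite ler_nat. Qed.

Let predmE : (m.-1)%:R = m%:R - 1 :> R.
Proof. by rewrite -subn1 natrB // ltnW. Qed.

(** The hypothesis on ln n makes (m - 1) / (2 ln n) at most 1, whence k <= n
    and ln k <= ln n.  If eps >= 1, the hypothesis on k leaves only k = 0. *)
Lemma colorable_prob_multipartite_le (n k : nat) (eps : R) :
  0 < eps -> (0 < n)%N -> m%:R <= ln n%:R :> R ->
  k%:R <= (1 - eps) * ((m%:R - 1) * n%:R / (2 * ln n%:R)) ->
  colorable_prob (complete_multipartite m n) k R <= (eps * ln n%:R)^-1.
Proof.
move=> eps_gt0 n_gt0; set L := ln n%:R => mL k_le.
have n_gt0R : 1 <= n%:R :> R by rewrite ler1n.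
have m_gt0R : 1 < m%:R :> R by have := m_ge2R; lra.
have L_gt0 : 0 < L by lra.
have t_gt0 : 0 < (m%:R - 1) * n%:R / (2 * L) by rewrite divr_gt0 ?mulr_gt0 //; lra.
apply: (le_trans (colorable_prob_first_moment _ _ _)).
rewrite card_complete_multipartite; set E := #|edge _|.
have [->|k_gt0] := posnP k.
  rewrite expr0n muln_eq0 -!leqn0 leqNgt (ltnW m_ge2) leqNgt n_gt0 mul0r.
  by rewrite invr_ge0 mulr_ge0 // ltW.
have q_ge1 : 1 <= k%:R :> R by rewrite ler1n.
have q_gt0 : 0 < k%:R :> R by lra.
have k_leL : k%:R * (2 * L) <= (1 - eps) * ((m%:R - 1) * n%:R).
  by rewrite -ler_pdivlMr ?mulr_gt0 // -mulrA.
have eps_lt1 : eps < 1.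
  rewrite ltNge; apply/negP => eps1.
  have : (1 - eps) * ((m%:R - 1) * n%:R / (2 * L)) <= 0 by nra.
  lra.
have k_le_n : k%:R <= n%:R :> R.
  have : (1 - eps) * ((m%:R - 1) * n%:R) <= (2 * L) * n%:R.
    by rewrite mulrA ler_wpM2r //; nra.
  move=> /(le_trans k_leL); rewrite [leRHS]mulrC ler_pM2r //; lra.
have lnk_le : ln k%:R <= L by rewrite ler_ln ?posrE //; lra.
have E2 : E%:R * 2 = m%:R * n%:R * ((m%:R - 1) * n%:R) :> R.
  rewrite -predmE -natrM muln2 /E card_edge_complete_multipartite.
  by rewrite !natrM.
have EL : m%:R * n%:R * ((1 + eps) * L) <= E%:R / k%:R.
  rewrite ler_pdivlMr //.
  suff : (1 + eps) * L * k%:R * 2 <= (m%:R - 1) * n%:R.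
    move=> H; have : 0 <= m%:R * n%:R :> R by rewrite mulr_ge0.
    move=> mn0; have := ler_wpM2l mn0 H; rewrite -E2; lra.
  have : (1 + eps) * (k%:R * (2 * L)) <= (1 + eps) * ((1 - eps) * ((m%:R - 1) * n%:R)).
    by rewrite ler_pM2l //; lra.
  have : 0 <= (m%:R - 1) * n%:R :> R by rewrite mulr_ge0 //; lra.
  nra.
have -> : k%:R ^+ (m * n) = expR ((m * n)%:R * ln k%:R) :> R.
  by rewrite expRM_natl lnK.
have pow_le : (1 - k%:R^-1) ^+ E <= expR (- (E%:R / k%:R)) :> R.
  rewrite -mulrN expRM_natl lerXn2r ?nnegrE ?expR_ge0 //.
    by rewrite subr_ge0 invf_le1.
  exact: expR_ge1Dx.
apply: (@le_trans _ _ (expR (- (m%:R * n%:R * (eps * L))))).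
  apply: (le_trans (ler_wpM2l (expR_ge0 _) pow_le)).
  rewrite -expRD ler_expR natrM.
  have : m%:R * n%:R * ln k%:R <= m%:R * n%:R * L by rewrite ler_wpM2l ?mulr_ge0.
  move: (_ * ln _) EL => y; rewrite mulrDl mul1r mulrDr.
  move: (E%:R / _) (_ * L) (_ * (eps * L)) => c d e; clear; lra.
have eL_gt0 : 0 < eps * L by rewrite mulr_gt0.
rewrite expRN lef_pV2 ?posrE ?expR_gt0 //.
apply: (@le_trans _ _ (m%:R * n%:R * (eps * L))).
  by rewrite ler_peMl ?(ltW eL_gt0) // -natrM ler1n muln_gt0 n_gt0 andbT ltnW.
by apply: le_trans (expR_ge1Dx _); rewrite lerDr.
Qed.

End Bounds.

(** * Complete multipartite graphs: enough colors *)

(** Real inequalities satisfied by a list size q that exceeds the threshold by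
    a factor 1 + eps, where L stands for ln n.  The lower bound L^6 / 6! on n
    is a term of the series of exp L; it gives (1 + eps) times the threshold
    the lower bound L^5 / (2 * 6!), which explains the constant 1440. *)
Section ListSize.
Variables (R : realType) (m eps n L q : R).
Hypothesis m_ge2 : 2 <= m.
Hypothesis eps_gt0 : 0 < eps.
Hypothesis L_ge1 : 1 <= L.
Hypothesis L_large : 1440 * (2 + 2 / eps) <= L.
Hypothesis n_large : L ^+ 6 <= 720 * n.
Hypothesis q_large : (1 + eps) * ((m - 1) * n / (2 * L)) <= q.

Let K := (1 + eps) * ((m - 1) * n / (2 * L)).

Let n_gt0 : 0 < n.
Proof.
have : 1 <= L ^+ 6 by rewrite exprn_ege1.
move: n_large; lra.
Qed.

Let KL : K * (2 * L) = (1 + eps) * ((m - 1) * n).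
Proof. by rewrite /K; field; apply: lt0r_neq0; move: L_ge1; lra. Qed.

Let nLK : n <= K * (2 * L).
Proof.
have n_le : n <= (m - 1) * n by rewrite ler_peMl ?(ltW n_gt0) //; move: m_ge2; lra.
rewrite KL; apply: (le_trans n_le); rewrite ler_peMl ?lerDl ?(ltW eps_gt0) //.
by apply: le_trans n_le; exact: ltW.
Qed.

Let K_large : 2 + 2 / eps <= K.
Proof.
have L_gt0 : 0 < L by exact: lt_le_trans ltr01 L_ge1.
have L5 : L <= L ^+ 5 by rewrite exprS ler_peMr ?(ltW L_gt0) // exprn_ege1.
have : L * L ^+ 5 <= L * (1440 * K).
  rewrite -exprS; apply: (le_trans n_large); move: nLK; lra.
rewrite ler_pM2l // => L5K.
move: L_large L5K L5; lra.
Qed.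

Let eK : 2 * eps + 2 <= eps * K.
Proof.
have := ler_wpM2l (ltW eps_gt0) K_large.
by rewrite mulrDr mulrCA divff ?gt_eqF // mulr1 (mulrC eps 2).
Qed.

Let K_ge2 : 2 <= K.
Proof. by apply: le_trans K_large; rewrite lerDl divr_ge0 // ltW. Qed.

Lemma list_size_gt1 : 1 < q.
Proof. apply: lt_le_trans q_large; move: K_ge2; rewrite -/K; lra. Qed.

(** Since K >= 2, q - 1 is at least K / 2, and K >= n / (2 L). *)
Lemma list_size_inv_le : (q - 1)^-1 <= 4 * L / n.
Proof.
have q1 := list_size_gt1; have L0 := L_ge1; have n0 := n_gt0.
rewrite -[leRHS]invrK lef_pV2 ?posrE ?invr_gt0 ?divr_gt0 ?mulr_gt0 //; try lra.
rewrite invf_div ler_pdivrMr; last lra.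
have : 1 * K <= 2 * (q - 1) by move: q_large K_ge2; rewrite -/K; lra.
move=> Kq; apply: (le_trans nLK).
have := ler_wpM2r (_ : 0 <= 2 * L) Kq; lra.
Qed.

(** At the threshold itself (m - 1) n / (2 q) would be L; the factor 1 + eps
    lowers this to L / (1 + eps), and half of the gain pays for replacing q by
    q - 1. *)
Lemma list_size_degree_le :
  (q - 1)^-1 * ((m - 1) * n / 2) <= (1 - eps / (2 * (1 + eps))) * L.
Proof.
have q1 := list_size_gt1; have L0 := L_ge1; have e0 := eps_gt0.
rewrite mulrC ler_pdivrMr; last lra.
have -> : (m - 1) * n / 2 = K * (2 * L) / (2 * (1 + eps)).
  by rewrite KL; field; apply: lt0r_neq0; lra.
have -> : 1 - eps / (2 * (1 + eps)) = (2 + eps) / (2 * (1 + eps)).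
  by field; apply: lt0r_neq0; lra.
have -> : (2 + eps) / (2 * (1 + eps)) * L * (q - 1)
   = ((2 + eps) * (q - 1)) * L / (2 * (1 + eps)).
  by field; apply: lt0r_neq0; lra.
rewrite ler_pM2r ?invr_gt0; last lra.
rewrite mulrA ler_pM2r; last lra.
have : (2 + eps) * (K - 1) <= (2 + eps) * (q - 1).
  rewrite ler_pM2l; first by rewrite lerD2r; exact: q_large.
  lra.
move: eK; lra.
Qed.

End ListSize.

Section ColorableSide.
Variables (R : realType) (m : nat).
Hypothesis m_ge2 : (2 <= m)%N.

(** The delta for which exp (x (m - 1) n / 2) <= n^(1 - delta). *)
Definition slack (eps : R) : R := eps / (2 * (1 + eps)).

(** The sum of the constants of the four error terms: N^2 x^3, x a^2, and the
    base of the geometric series in the ranges s <= k - 1 and s > k - 1. *)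
Definition error_const (eps : R) : R :=
  64 * 720 * m%:R ^+ 2 + 2880 + 4 * expR 1 ^+ 2 * m%:R
    + 96 * expR 1 * m%:R / slack eps ^+ 3.

Definition error_bound (z : R) : R := expR z * (expR z + 2 * z) - 1.

Lemma slack_gt0 eps : 0 < eps -> 0 < slack eps.
Proof. by move=> e0; rewrite divr_gt0 // mulr_gt0 // addr_gt0. Qed.

(** The case a = L^2 of [colorable_prob_second_moment_bound], with L = ln n.
    Every error term is a power of L over a positive power of n = exp L, and
    the exponential series turns it into a constant over L. *)
Lemma colorable_prob_multipartite_ge (n k : nat) (eps : R) :
  0 < eps -> 1 <= ln n%:R :> R -> 1440 * (2 + 2 / eps) <= ln n%:R ->
  2 * error_const eps <= ln n%:R ->
  (1 + eps) * ((m%:R - 1) * n%:R / (2 * ln n%:R)) <= k%:R ->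
  1 - colorable_prob (complete_multipartite m n) k R
    <= error_bound (error_const eps / ln n%:R).
Proof.
move=> eps_gt0; set L := ln n%:R => L_ge1 L_large C_le q_large.
have m_ge2R : 2 <= m%:R :> R by rewrite ler_nat.
have m_ge0R : 0 <= m%:R :> R by rewrite ler0n.
have n_gt0 : 0 < n%:R :> R.
  rewrite ltr0n lt0n; apply: contraTneq L_ge1 => n0.
  by rewrite /L n0 ln0 // -ltNge ltr01.
have L_gt0 : 0 < L by exact: lt_le_trans ltr01 L_ge1.
have nE : n%:R = expR L by rewrite lnK.
have n_large : L ^+ 6 <= 720 * n%:R.
  have -> : 720 = 6`!%:R :> R by congr (_%:R); vm_compute.
  rewrite nE mulrC -ler_pdivrMr ?ltr0n ?fact_gt0 //.
  by apply: le_trans (expR_ge1Dxn 5 (ltW L_gt0)); rewrite lerDr.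
have q_gt1 := list_size_gt1 m_ge2R eps_gt0 L_ge1 L_large n_large q_large.
have k_gt1 : (1 < k)%N by rewrite -(ltr1n R).
have x_le := list_size_inv_le m_ge2R eps_gt0 L_ge1 L_large n_large q_large.
have deg_le := list_size_degree_le m_ge2R eps_gt0 L_ge1 L_large n_large q_large.
move: x_le deg_le; set x := (_ - 1)^-1; rewrite -/(slack _) => x_le deg_le.
have d_gt0 := slack_gt0 eps_gt0; move: d_gt0 deg_le.
rewrite /error_const in C_le *; move: (slack eps) C_le => d C_le d_gt0 deg_le.
have e_gt0 : 0 < expR 1 :> R by exact: expR_gt0.
have x_gt0 : 0 < x by rewrite invr_gt0 subr_gt0.
have c1 : 0 <= 64 * 720 * m%:R ^+ 2 :> R by rewrite !mulr_ge0 ?ler0n ?exprn_ge0.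
have c2 : 0 <= 4 * expR 1 ^+ 2 * m%:R :> R by rewrite !mulr_ge0 ?exprn_ge0 ?expR_ge0.
have c3 : 0 <= 96 * expR 1 * m%:R / d ^+ 3 by rewrite !mulr_ge0 ?invr_ge0 ?exprn_ge0 ?expR_ge0 // ltW.
set C := _ + _ + _ + _ in C_le *.
have C_gt0 : 0 < C by rewrite /C; lra.
have L5n : L ^+ 5 / n%:R <= 720 / L.
  by rewrite ler_pdivrMr // mulrAC ler_pdivlMr // -exprSr.
have moment1 : (m * n)%:R ^+ 2 * x ^+ 3 <= C / L.
  apply: (@le_trans _ _ (64 * 720 * m%:R ^+ 2 / L)); last first.
    by rewrite ler_pM2r ?invr_gt0 // /C; lra.
  have x3 : x ^+ 3 <= (4 * L / n%:R) ^+ 3.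
    by rewrite lerXn2r ?nnegrE ?divr_ge0 ?mulr_ge0 ?(ltW x_gt0) ?(ltW L_gt0) ?(ltW n_gt0).
  apply: (le_trans (ler_wpM2l (sqr_ge0 _) x3)).
  have -> : (m * n)%:R ^+ 2 * (4 * L / n%:R) ^+ 3 = 64 * m%:R ^+ 2 * (L ^+ 3 / n%:R) :> R.
    by rewrite natrM; field; exact: lt0r_neq0.
  have -> : 64 * 720 * m%:R ^+ 2 / L = 64 * m%:R ^+ 2 * (720 / L) by field; exact: lt0r_neq0.
  rewrite ler_wpM2l ?mulr_ge0 ?exprn_ge0 //; apply: le_trans L5n.
  by rewrite ler_pM2r ?invr_gt0 // ler_weXn2l.
have moment2 : x * (L ^+ 2) ^+ 2 <= C / L.
  apply: (@le_trans _ _ (2880 / L)); last first.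
    by rewrite ler_pM2r ?invr_gt0 // /C; lra.
  apply: (le_trans (ler_wpM2r (sqr_ge0 _) x_le)).
  have -> : 4 * L / n%:R * L ^+ 2 ^+ 2 = 4 * (L ^+ 5 / n%:R) by ring.
  by move: L5n; lra.
have tail s : L ^+ 2 < s%:R -> (s <= #|complete_multipartite m n|)%N ->
    expR 1 * #|complete_multipartite m n|%:R / (s%:R * k%:R) *
      expR (x * (minn s (m.-1 * n))%:R / 2) <= C / L.
  move=> s_gt _; rewrite card_complete_multipartite natrM invfM.
  have s_gt0 : 0 < s%:R :> R by apply: lt_trans s_gt; rewrite exprn_gt0.
  have k_inv : k%:R^-1 <= x.
    rewrite lef_pV2 ?posrE ?subr_gt0 ?gerBl //.
    exact: lt_trans q_gt1.
  (* For s <= k - 1 the exponential is at most e, and s > L^2 makes the base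
     small; for larger s the degree bound saves a factor n^delta. *)
  have [s_le|s_ge] := leP s%:R (k%:R - 1 : R).
    have exp_le : expR (x * (minn s (m.-1 * n))%:R / 2) <= expR 1.
      rewrite ler_expR.
      have : x * (minn s (m.-1 * n))%:R <= 1.
        rewrite mulrC ler_pdivrMr ?subr_gt0 // mul1r; apply: le_trans s_le.
        by rewrite ler_nat geq_minl.
      by have := mulr_ge0 (ltW x_gt0) (ler0n R (minn s (m.-1 * n))); lra.
    have sk : s%:R^-1 * k%:R^-1 <= L ^- 2 * (4 * L / n%:R).
      apply: ler_pM; rewrite ?invr_ge0 //; last exact: le_trans x_le.
      by rewrite lef_pV2 ?posrE ?exprn_gt0 // ltW.
    apply: (@le_trans _ _ (expR 1 * (m%:R * n%:R) * (L ^- 2 * (4 * L / n%:R)) * expR 1)).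
      apply: ler_pM => //; rewrite ?expR_ge0 //.
      by rewrite ler_wpM2l ?mulr_ge0 ?expR_ge0.
    have -> : expR 1 * (m%:R * n%:R) * (L ^- 2 * (4 * L / n%:R)) * expR 1
        = (4 * expR 1 ^+ 2 * m%:R) / L.
      by field; rewrite !lt0r_neq0.
    by rewrite ler_pM2r ?invr_gt0 // /C; lra.
  have exp_le : expR (x * (minn s (m.-1 * n))%:R / 2) <= n%:R * (6 / (d * L) ^+ 3).
    apply: (@le_trans _ _ (expR ((1 - d) * L))).
      rewrite ler_expR; apply: le_trans deg_le; rewrite -mulrA ler_pM2l //.
      rewrite ler_pM2r ?invr_gt0 //.
      apply: (@le_trans _ _ (m.-1 * n)%:R); first by rewrite ler_nat geq_minr.
      by rewrite natrM -subn1 natrB // ltnW.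
    rewrite mulrBl mul1r expRB nE ler_pM2l ?expR_gt0 //.
    rewrite -[leRHS]invrK lef_pV2 ?posrE ?expR_gt0 ?invr_gt0 ?divr_gt0 ?exprn_gt0 ?mulr_gt0 //.
    rewrite invf_div.
    by apply: le_trans (expR_ge1Dxn 2 (ltW (mulr_gt0 d_gt0 L_gt0))); rewrite lerDr.
  have sk : s%:R^-1 * k%:R^-1 <= (4 * L / n%:R) ^+ 2.
    rewrite expr2; apply: ler_pM; rewrite ?invr_ge0 //; apply: le_trans x_le => //.
    by rewrite lef_pV2 ?posrE ?subr_gt0 // ltW.
  apply: (@le_trans _ _ (expR 1 * (m%:R * n%:R) * (4 * L / n%:R) ^+ 2
                          * (n%:R * (6 / (d * L) ^+ 3)))).
    apply: ler_pM => //; rewrite ?expR_ge0 //.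
    by rewrite ler_wpM2l ?mulr_ge0 ?expR_ge0.
  have -> : expR 1 * (m%:R * n%:R) * (4 * L / n%:R) ^+ 2 * (n%:R * (6 / (d * L) ^+ 3))
      = (96 * expR 1 * m%:R / d ^+ 3) / L.
    by field; rewrite !lt0r_neq0.
  by rewrite ler_pM2r ?invr_gt0 // /C; lra.
have b_bounds : 0 <= C / L <= 2^-1.
  by rewrite divr_ge0 ?(ltW C_gt0) ?(ltW L_gt0) //= ler_pdivrMr // ler_pdivlMl.
have deg (u : complete_multipartite m n) : (#|[set v | adj u v]| <= m.-1 * n)%N.
  by rewrite degree_complete_multipartite.
apply: le_trans (colorable_prob_second_moment_bound k_gt1 deg (sqr_ge0 L) b_bounds tail) _.
rewrite /error_bound lerD2r card_complete_multipartite -/x.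
apply: ler_pM; rewrite ?expR_ge0 ?lerD2r ?ler_expR //.
by rewrite addr_ge0 ?expR_ge0 // mulr_ge0 // divr_ge0 // ltW.
Qed.

End ColorableSide.

(** * Limits *)

Section Limits.
Local Open Scope classical_set_scope.
Variable R : realType.

Lemma near_ln_ge (A : R) : \forall n \near \oo, A <= ln n%:R.
Proof.
near=> n; rewrite -[A]expRK ler_ln ?posrE ?expR_gt0 //.
  by near: n; exact: nbhs_infty_ger.
apply: lt_le_trans (expR_gt0 A) _.
by near: n; exact: nbhs_infty_ger.
Unshelve. all: by end_near. Qed.

Lemma cvg_div_ln (C : R) : C / ln n%:R @[n --> \oo] --> 0.
Proof.
apply/cvgrPdist_le => e e_gt0; near=> n.
have L_ge : (`|C| + 1) / e <= ln n%:R by near: n; exact: near_ln_ge.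
have L_gt0 : 0 < ln n%:R :> R.
  by apply: lt_le_trans L_ge; rewrite divr_gt0 // ltr_wpDl.
rewrite sub0r normrN normf_div (gtr0_norm L_gt0) ler_pdivrMr //.
by move: L_ge; rewrite ler_pdivrMr // mulrC; lra.
Unshelve. all: by end_near. Qed.

Lemma cvg_error_bound (z : nat -> R) :
  z n @[n --> \oo] --> 0 -> error_bound (z n) @[n --> \oo] --> 0.
Proof.
move=> z0.
have expz : expR (z n) @[n --> \oo] --> (1 : R).
  by rewrite -expR0; apply: continuous_cvg => //; exact: continuous_expR.
rewrite (_ : 0 = 1 * (1 + 2 * 0) - 1 :> R); last by ring.
apply: cvgB; last exact: cvg_cst.
apply: cvgM => //; apply: cvgD => //.
by apply: cvgM => //; exact: cvg_cst.
Qed.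

End Limits.

Theorem corollary1p7 (R : realType) (m : nat) (m_ge2 : (2 <= m)%N) :
  sharp_dp_threshold (fun n : nat => complete_multipartite m n)
    (fun n : nat => (m%:R - 1) * n%:R / (2 * ln n%:R) : R).
Proof.
move=> eps kappa eps_gt0; split=> kappa_bound.
  apply: (@squeeze_cvgr _ _ _ _ (fun=> 0) (fun n => eps^-1 / ln n%:R)); last first.
  - exact: cvg_div_ln.
  - exact: cvg_cst.
  near=> n; rewrite colorable_prob_ge0 /= -invfM.
  apply: colorable_prob_multipartite_le => //.
  - by near: n; exact: nbhs_infty_gt.
  - by near: n; exact: near_ln_ge.
  - by near: n; exact: kappa_bound.
apply: (@squeeze_cvgr _ _ _ _
   (fun n => 1 - error_bound (error_const m eps / ln n%:R)) (fun=> 1)); last first.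
- exact: cvg_cst.
- rewrite -[X in cvg_to _ (nbhs X)]subr0; apply: cvgB; first exact: cvg_cst.
  by apply: cvg_error_bound; exact: cvg_div_ln.
near=> n; rewrite colorable_prob_le1 andbT lerBlDr -lerBlDl.
apply: colorable_prob_multipartite_ge => //; last by near: n; exact: kappa_bound.
- by near: n; exact: near_ln_ge.
- by near: n; exact: near_ln_ge.
- by near: n; exact: near_ln_ge.
Unshelve. all: by end_near. Qed.
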